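(* Let $C\subset\mathbb{R}^2$ be a compact connected region, let $x_1\neq x_2$ be two points of $C$ (the sensor positions), and let $V_1=\{x\in C:\|x-x_1\|\le\|x-x_2\|\}$ and $V_2=\{x\in C:\|x-x_2\|\le\|x-x_1\|\}$ be their Voronoi regions. Let the source be at $s\in C$. Then, as the number $k$ of aggregated measurements per sensor tends to infinity, the MAP localization algorithm with localization regions $V_1,V_2$, using only the two sensors, finds the region containing $s$ with zero probability of error; that is, the probability that the region selected by MAP does not contain $s$ tends to $0$ as $k\to\infty$.
   Context: Let $P>0$, $d_0>0$, $\beta>2$, $\sigma>0$. Each sensor $i\in\{1,2\}$ takes $k$ independent measurements $\ln P_{r_i}(l)=\ln\frac{Pd_0}{d_0+\|x_i-s\|^\beta}+n_i(l)$, $l=1,\dots,k$, where the $n_i(l)$ are independent Gaussian with mean $0$ and variance $\sigma^2$ (independent across sensors and samples). The aggregated log-measurement, denoted $\ln\mathbf{P}_{r_i}(k)$, is their average, so it equals $\ln\frac{Pd_0}{d_0+\|x_i-s\|^\beta}$ plus Gaussian noise of variance $\sigma^2(k)=\sigma^2/k$. The source position has a uniform prior on $C$, with $A$ the area of $C$. $H_j$ is the hypothesis that the source lies in $V_j$, and $$p(\ln\mathbf{P}_{r_1}(k),\ln\mathbf{P}_{r_2}(k)\mid H_j)P(H_j)=\frac1A\int_{V_j}\prod_{i=1}^{2}\frac{1}{(2\pi\sigma^2(k))^{1/2}}\exp\Big(-\frac{\big(\ln\mathbf{P}_{r_i}(k)-\ln\frac{Pd_0}{d_0+\|x_i-y\|^\beta}\big)^2}{2\sigma^2(k)}\Big)dy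 .$$ The MAP algorithm selects the region $V_{j^*}$ with $j^*\in\arg\max_{j\in\{1,2\}}p(\ln\mathbf{P}_{r_1}(k),\ln\mathbf{P}_{r_2}(k)\mid H_j)P(H_j)$.
   Formalization: The compact connected region C is also assumed to be the closure of its interior; otherwise the claim can fail, e.g. for a disc with an attached arc when the Voronoi region containing s lies in the arc and has zero area. *)

(* Defs.v *)
From HB Require Import structures.
From mathcomp Require Import all_boot all_order all_algebra.
From mathcomp Require Import finmap.
From mathcomp Require Import all_classical all_reals all_analysis.

Set Implicit Arguments.
Unset Strict Implicit.
Unset Printing Implicit Defensive.

Import Order.TTheory GRing.Theory Num.Theory.
Import numFieldNormedType.Exports.

Local Open Scope classical_set_scope.
Local Open Scope ring_scope.

(* The plane is [R * R], whose product topology is the Euclidean one.  The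
   library norm on a product is the max norm, so the Euclidean distance is
   spelled out. *)
Definition edist (R : realType) (u v : R * R) : R :=
  Num.sqrt ((u.1 - v.1) ^+ 2 + (u.2 - v.2) ^+ 2).

Definition planar_measure (R : realType) :=
  (@lebesgue_measure R \x @lebesgue_measure R)%E.

(* A closed region, as opposed to an arbitrary closed set, is the closure of an
   open set.  This excludes parts of zero area (isolated arcs, for instance),
   which a uniform prior on [C] cannot see. *)
Definition compact_connected_region (R : realType) (C : set (R * R)) : Prop :=
  [/\ compact C, connected C & closure (interior C) = C].

Definition voronoi (R : realType) (C : set (R * R)) (x : 'I_2 -> R * R)
    (j : 'I_2) : set (R * R) :=
  [set y | C y /\ forall i, edist y (x j) <= edist y (x i)].

Definition log_mean (R : realType) (P d0 beta : R) (xi y : R * R) : R :=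
  ln (P * d0 / (d0 + edist xi y `^ beta)).

(* Mutual independence, through the product rule on finite subfamilies. *)
Definition independent_RVs d (T : measurableType d) (R : realType)
    (Pr : probability T R) (I : choiceType) (X : I -> {RV Pr >-> R}) : Prop :=
  forall (F : {fset I}) (B : I -> set R), (forall i, measurable (B i)) ->
    Pr (\bigcap_(i in [set` F]) X i @^-1` B i) =
    (\prod_(i <- F) Pr (X i @^-1` B i))%E.

(* The laws are compared on measurable sets only: the value of a measure on a
   non-measurable set is unspecified. *)
Definition centered_gaussian d (T : measurableType d) (R : realType)
    (Pr : probability T R) (sigma : R) (X : {RV Pr >-> R}) : Prop :=
  forall B : set R, measurable B -> distribution Pr X B = normal_prob 0 sigma B.

(* [n i l] is the noise of the [l.+1]-th sample of sensor [i]. *)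
Definition log_measurement (R : realType) (T : Type) (P d0 beta : R)
    (x : 'I_2 -> R * R) (s : R * R) (n : 'I_2 -> nat -> T -> R)
    (i : 'I_2) (l : nat) (w : T) : R :=
  log_mean P d0 beta (x i) s + n i l w.

Definition aggregated (R : realType) (T : Type) (P d0 beta : R)
    (x : 'I_2 -> R * R) (s : R * R) (n : 'I_2 -> nat -> T -> R)
    (k : nat) (w : T) (i : 'I_2) : R :=
  k%:R^-1 * \sum_(l < k) log_measurement P d0 beta x s n i l w.

(* [p(z | H_j) * P(H_j)] where [z i] is the aggregated log-measurement of
   sensor [i] and [v] is the variance of its noise. *)
Definition map_score (R : realType) (P d0 beta : R) (C : set (R * R))
    (x : 'I_2 -> R * R) (v : R) (z : 'I_2 -> R) (j : 'I_2) : R :=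
  (fine (@planar_measure R C))^-1 *
  \int[@planar_measure R]_(y in voronoi C x j)
    \prod_(i < 2) ((Num.sqrt (2 * pi * v))^-1 *
      expR (- ((z i - log_mean P d0 beta (x i) y) ^+ 2 / (2 * v)))).

(* For each [k >= 1], [jstar k] selects a maximiser of the MAP score.  Ties are
   broken arbitrarily (possibly using extra randomness), but measurably, so that
   events about the selected region have a probability. *)
Definition MAP_rule d (T : measurableType d) (R : realType)
    (P d0 beta sigma : R) (C : set (R * R)) (x : 'I_2 -> R * R) (s : R * R)
    (n : 'I_2 -> nat -> T -> R) (jstar : nat -> T -> 'I_2) : Prop :=
  forall k, (0 < k)%N ->
    (forall j, measurable [set w | jstar k w = j]) /\
    (forall w j,
       let score := map_score P d0 beta C x (sigma ^+ 2 / k%:R)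
                      (aggregated P d0 beta x s n k w) in
       score j <= score (jstar k w)).

(* Main.v *)
Require Import Defs.
From HB Require Import structures.
From mathcomp Require Import all_boot all_order all_algebra.
From mathcomp Require Import finmap.
From mathcomp Require Import all_classical all_reals all_analysis.
From mathcomp Require Import measurable_realfun.
From mathcomp Require Import ring lra.

Set Implicit Arguments.
Unset Strict Implicit.
Unset Printing Implicit Defensive.

Import Order.TTheory GRing.Theory Num.Theory.
Import numFieldNormedType.Exports.

Local Open Scope classical_set_scope.
Local Open Scope ring_scope.

(** Two circles centred at the sensors, through the source, meet again at
most at the mirror image of the source in the line of the sensors, which lies on
the same side of the bisector.  The noiseless pair of log-powers therefore
determines the Voronoi region of the source, although not its position.  No
geometry is needed to see it, only monotonicity: if the source is at distance
r1 from the near sensor and r2 > r1 from the far one, and t lies between, then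
at a point of the other region either the far sensor is within t, hence hears
a power above that at r2, or the near sensor is beyond t, hence hears a power
below that at r1.  This misfit is bounded below by some eta
([log_mean_gap]).

The averaged noise of each sensor tends to 0 in probability.  This is
Chebyshev's inequality ([gaussian_mean_tail]); it requires that independent
square-integrable variables are uncorrelated
([expectation_prod_independent]) and that a centred Gaussian law, being
symmetric with a finite second moment, gives centred square-integrable
variables.

When both averages are within eta / 8 of their noiseless values, the MAP score
separates the regions for a small variance v ([map_score_separation]), by
Laplace's method.  On the wrong region the integrand is at most a constant
times exp (- eta ^ 2 / (4 v)).  Since C is the closure of its interior, it
contains a ball near the source where the model fits up to eta / 8, and there
the integrand is at least the same constant times exp (- eta ^ 2 / (16 v)).  The
ratio of the areas is fixed, so the second bound wins once k is large, and the
MAP rule errs only if one of the two averages deviates by eta / 8.  A source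
equidistant from the sensors belongs to both regions, and no error is
possible. *)

(* The Euclidean distance of the plane, not the extended distance of a
   pseudometric space, which bears the same name. *)
Local Notation edist := Defs.edist.

(** * Weak law of large numbers for independent Gaussian noise *)

(** The product rule says that the law of the pair is the product of the laws
on rectangles, hence everywhere; then Fubini's theorem applies.  Square
integrability serves to make the product integrable. *)
Lemma expectation_prod_independent d (T : measurableType d) (R : realType)
    (Pr : probability T R) (X Y : {RV Pr >-> R}) :
    (forall A B : set R, measurable A -> measurable B ->
       Pr (X @^-1` A `&` Y @^-1` B) = (Pr (X @^-1` A) * Pr (Y @^-1` B))%E) ->
    (X : T -> R) \in Lfun Pr 2%:E -> (Y : T -> R) \in Lfun Pr 2%:E ->
  ('E_Pr[(X : T -> R) * (Y : T -> R)] = 'E_Pr[X] * 'E_Pr[Y])%E.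
Proof.
move=> XY X2 Y2.
have Pfin : Pr setT \is a fin_num := fin_num_measure Pr _ measurableT.
have iXY : Pr.-integrable setT (EFin \o ((X : T -> R) * (Y : T -> R))).
  exact/Lfun1_integrable/Lfun2_mul_Lfun1.
have iX : Pr.-integrable setT (EFin \o X).
  exact/Lfun1_integrable/Lfun_subset12.
have iY : Pr.-integrable setT (EFin \o Y).
  exact/Lfun1_integrable/Lfun_subset12.
have mZ : measurable_fun setT (fun w => (X w, Y w)).
  exact: measurable_fun_pair.
pose Z : {mfun T >-> (R * R)%type} :=
  HB.pack (fun w => (X w, Y w)) (isMeasurableFun.Build _ _ _ _ _ mZ).
pose PX := distribution Pr X.
pose PY := distribution Pr Y.
pose f : R * R -> \bar R := fun p => (p.1 * p.2)%:E.
have mf : measurable_fun setT f.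
  by apply/measurable_EFinP; exact: measurable_funM.
have ZE A : measurable A -> (PX \x PY)%E A = distribution Pr Z A.
  move=> mA.
  by apply: (@product_measure_unique _ _ _ _ _ PX PY (distribution Pr Z)).
have ifZ : (PX \x PY)%E.-integrable setT f.
  apply/integrableP; split=> //.
  rewrite (eq_measure_integral (distribution Pr Z)); last first.
    by move=> A mA _; exact: ZE.
  rewrite ge0_integral_distribution//; last exact: measurableT_comp.
  by move/integrableP : iXY => [_].
rewrite unlock.
transitivity (\int[distribution Pr Z]_p f p)%E.
  by rewrite integral_distribution.
rewrite (eq_measure_integral (PX \x PY)%E); last first.
  by move=> A mA _; exact/esym/ZE.
rewrite -integral12_prod_meas1//.
have iPY : PY.-integrable setT (EFin : R -> \bar R).
  exact: integrable_pushforward.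
have iPX : PX.-integrable setT (EFin : R -> \bar R).
  exact: integrable_pushforward.
have EY : (\int[PY]_y y%:E = \int[Pr]_w (Y w)%:E)%E.
  by rewrite integral_distribution.
have EX : (\int[PX]_y y%:E = \int[Pr]_w (X w)%:E)%E.
  by rewrite integral_distribution.
rewrite -EY -EX.
have Yfin : (\int[PY]_y y%:E)%E \is a fin_num by exact: integrable_fin_num.
transitivity (\int[PX]_x (x%:E * \int[PY]_y y%:E))%E.
  apply: eq_integral => x _.
  rewrite /fubini_F /f/=; under eq_integral do rewrite EFinM.
  by rewrite integralZl.
by rewrite -(fineK Yfin) integralZr.
Qed.

Lemma lebesgue_measure_preimage_opp (R : realType) (A : set R) : measurable A ->
  lebesgue_measure (-%R @^-1` A) = lebesgue_measure A.
Proof.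
move=> mA.
have mopp : measurable_fun setT (-%R : measurableTypeR R -> measurableTypeR R).
  exact: oppr_measurable.
pose nu : {measure set (measurableTypeR R) -> \bar R} :=
  measure_function_pushforward__canonical__measure_function_Measure
    (@lebesgue_measure R) mopp.
rewrite [RHS](@lebesgue_measure_unique R nu)// => _ [[a b] /= _ <-].
rewrite /nu/= /pushforward (_ : -%R @^-1` _ = `[- b, - a[%classic); last first.
  by apply/seteqP; split=> x /=; rewrite !in_itv/= lerNl ltrNr andbC.
by rewrite !lebesgue_measure_itv/= !lte_fin ltrN2 opprK addrC.
Qed.

Lemma normal_prob_preimage_opp (R : realType) (sigma : R) (A : set R) :
    0 < sigma -> measurable A ->
  normal_prob 0 sigma (-%R @^-1` A) = normal_prob 0 sigma A.
Proof.
move=> s0 mA; rewrite /normal_prob.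
have mf (D : set R) : measurable_fun D (fun x : R => (normal_pdf 0 sigma x)%:E).
  by apply/measurable_EFinP/measurable_funTS; exact: measurable_normal_pdf.
have mopp : measurable_fun setT (-%R : measurableTypeR R -> measurableTypeR R).
  exact: oppr_measurable.
pose nu : {measure set (measurableTypeR R) -> \bar R} :=
  measure_function_pushforward__canonical__measure_function_Measure
    (@lebesgue_measure R) mopp.
rewrite [RHS](@eq_measure_integral _ _ _ _ nu); last first.
  by move=> B mB _; exact/esym/lebesgue_measure_preimage_opp.
rewrite ge0_integral_pushforward//; last first.
  by move=> y _; rewrite lee_fin normal_pdf_ge0.
  exact: mf.
apply: eq_integral => x _ /=; congr EFin.
by rewrite !normal_pdfE ?gt_eqF// /normal_fun !subr0 sqrrN.
Qed.

(** With t = 3 y ^ 2 / (8 sigma ^ 2), the ratio of the Gaussian functions of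
deviations sigma and 2 sigma is exp (- t), and t exp (- t) <= 1.  This compares
the second moment with the total mass of a wider Gaussian. *)
Lemma sqr_normal_pdf_le (R : realType) (sigma y : R) : 0 < sigma ->
  y ^+ 2 * normal_pdf 0 sigma y <=
  (normal_peak sigma * (8 / 3 * sigma ^+ 2) / normal_peak (2 * sigma)) *
  normal_pdf 0 (2 * sigma) y.
Proof.
move=> s0; have s20 : 0 < 2 * sigma by rewrite mulr_gt0.
rewrite !normal_pdfE ?gt_eqF// /normal_fun !subr0.
rewrite [leRHS]mulrA divfK ?gt_eqF ?normal_peak_gt0 ?gt_eqF//.
rewrite mulrCA -[leRHS]mulrA ler_wpM2l ?normal_peak_ge0//.
pose t := 3 / 8 * (y ^+ 2 / sigma ^+ 2).
have -> : - y ^+ 2 / (sigma ^+ 2 *+ 2) = - y ^+ 2 / ((2 * sigma) ^+ 2 *+ 2) - t.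
  by rewrite /t; field; rewrite gt_eqF.
rewrite expRD mulrA mulrAC ler_wpM2r ?expR_ge0//.
have -> : y ^+ 2 = t * (8 / 3 * sigma ^+ 2) by rewrite /t; field; rewrite gt_eqF.
rewrite mulrAC ler_piMl ?mulr_ge0 ?exprn_ge0 ?(ltW s0)//.
rewrite expRN ler_pdivrMr ?expR_gt0// mul1r.
by rewrite (le_trans _ (expR_ge1Dx t))// lerDr.
Qed.

(** The density of [normal_prob] is its Radon-Nikodym derivative, which turns
the moment into an integral against Lebesgue measure. *)
Lemma normal_prob_second_moment (R : realType) (sigma : R) : 0 < sigma ->
  (\int[normal_prob 0 sigma]_y (y ^+ 2)%:E < +oo)%E.
Proof.
move=> s0.
pose mu := @lebesgue_measure R.
have msq : measurable_fun setT (fun y : R => (y ^+ 2)%:E).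
  by apply/measurable_EFinP; exact: exprn_measurable.
have mpdf s : measurable_fun setT (fun x : R => (normal_pdf 0 s x)%:E).
  by apply/measurable_EFinP; exact: measurable_normal_pdf.
have numu := normal_prob_dominates 0 sigma.
rewrite -(Radon_Nikodym_SigmaFinite.change_of_variables numu)//; last first.
  by move=> y; rewrite lee_fin sqr_ge0.
have iRN := Radon_Nikodym_SigmaFinite.f_integrable numu.
rewrite (@ae_eq_integral _ _ _ _ _
  (fun y : measurableTypeR R =>
    ((y : R) ^+ 2)%:E * (normal_pdf 0 sigma y)%:E)%E)//; last 3 first.
- by apply: emeasurable_funM; [exact: msq|exact: (measurable_int _ iRN)].
- by apply: emeasurable_funM; [exact: msq|exact: mpdf].
- apply: ae_eqe_mul2l; apply: integral_ae_eq.
  + by [].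
  + by [].
  + exact: mpdf.
  + by move=> E _ mE; rewrite -Radon_Nikodym_SigmaFinite.f_integral.
pose c := normal_peak sigma * (8 / 3 * sigma ^+ 2) / normal_peak (2 * sigma).
apply: (@le_lt_trans _ _ (\int[mu]_y (c%:E * (normal_pdf 0 (2 * sigma) y)%:E))%E).
  apply: ge0_le_integral => //.
  - by move=> y _; rewrite -EFinM lee_fin mulr_ge0 ?sqr_ge0 ?normal_pdf_ge0.
  - by apply: emeasurable_funM; [exact: msq|exact: mpdf].
  - by apply: emeasurable_funM; [exact: measurable_cst|exact: mpdf].
  - by move=> y _; rewrite -!EFinM lee_fin sqr_normal_pdf_le.
rewrite integralZl//= ?integral_normal_pdf ?mule1 ?ltry//.
exact: integrable_normal_pdf.
Qed.

(** The random variable is composed with the identity into [measurableTypeR],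
the copy of the reals on which [normal_prob] is defined. *)
Lemma centered_gaussian_integral d (T : measurableType d) (R : realType)
    (Pr : probability T R) (sigma : R) (X : {RV Pr >-> R})
    (gX : centered_gaussian sigma X) (f : R -> \bar R) :
    measurable_fun setT f -> (forall y, (0 <= f y)%E) ->
  (\int[Pr]_w f (X w) = \int[normal_prob 0 sigma]_y f y)%E.
Proof.
move=> mf f0.
have mX : measurable_fun setT (X : T -> measurableTypeR R).
  exact: (measurable_funPT X).
rewrite -[RHS](@eq_measure_integral _ _ _ _ _
  (measure_function_pushforward__canonical__measure_function_Measure Pr mX)).
  rewrite ge0_integral_pushforward//; exact: mf.
by move=> A mA _; exact: gX.
Qed.

Lemma centered_gaussian_second_moment d (T : measurableType d) (R : realType)
    (Pr : probability T R) (sigma : R) (X : {RV Pr >-> R}) :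
    centered_gaussian sigma X ->
  ('E_Pr[(X : T -> R) ^+ 2] = \int[normal_prob 0 sigma]_y (y ^+ 2)%:E)%E.
Proof.
move=> gX; rewrite unlock.
rewrite -(centered_gaussian_integral gX (f := fun y => (y ^+ 2)%:E))//.
  by apply/measurable_EFinP; exact: exprn_measurable.
by move=> y; rewrite lee_fin sqr_ge0.
Qed.

Lemma Lfun2_second_moment d (T : measurableType d) (R : realType)
    (Pr : probability T R) (X : {RV Pr >-> R}) :
  ('E_Pr[(X : T -> R) ^+ 2] < +oo)%E -> (X : T -> R) \in Lfun Pr 2%:E.
Proof.
rewrite unlock => X2.
rewrite inE; apply/andP; split; first by rewrite inE/=.
rewrite inE/= /finite_norm unlock /Lnorm poweR_lty//.
apply: le_lt_trans X2; rewrite le_eqVlt; apply/orP; left; apply/eqP.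
by apply: eq_integral => w _ /=; rewrite powR_mulrn// real_normK ?num_real.
Qed.

Lemma centered_gaussian_Lfun2 d (T : measurableType d) (R : realType)
    (Pr : probability T R) (sigma : R) (X : {RV Pr >-> R}) :
  0 < sigma -> centered_gaussian sigma X -> (X : T -> R) \in Lfun Pr 2%:E.
Proof.
move=> s0 gX; apply: Lfun2_second_moment.
by rewrite (centered_gaussian_second_moment gX); exact: normal_prob_second_moment.
Qed.

(** By symmetry of the Gaussian law, X and - X have the same distribution. *)
Lemma centered_gaussian_expectation d (T : measurableType d) (R : realType)
    (Pr : probability T R) (sigma : R) (X : {RV Pr >-> R}) :
  0 < sigma -> centered_gaussian sigma X -> ('E_Pr[X] = 0)%E.
Proof.
move=> s0 gX.
have Pfin : Pr setT \is a fin_num := fin_num_measure Pr _ measurableT.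
have X1 : (X : T -> R) \in Lfun Pr 1.
  by apply: Lfun_subset12 => //; exact: centered_gaussian_Lfun2 gX.
have iX : Pr.-integrable setT (EFin \o X) by exact/Lfun1_integrable.
pose Y : {RV Pr >-> R} := (\- X)%R.
have iY : Pr.-integrable setT (EFin \o Y).
  by apply/Lfun1_integrable; rewrite rpredN.
have EY : ('E_Pr[Y] = - 'E_Pr[X])%E.
  by rewrite unlock -integralN//=; exact: integrable_add_def.
have EXY : ('E_Pr[X] = 'E_Pr[Y])%E.
  rewrite unlock.
  rewrite -[LHS](@integral_distribution _ _ _ _ _ _ X EFin)//.
  rewrite -[RHS](@integral_distribution _ _ _ _ _ _ Y EFin)//.
  apply: eq_measure_integral => A mA _; rewrite [LHS]gX//.
  rewrite -normal_prob_preimage_opp// -gX//.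
  by rewrite -[X in measurable X]setTI; exact: oppr_measurable.
have Efin : ('E_Pr[X])%E \is a fin_num by exact: expectation_fin_num.
move: EXY; rewrite EY -(fineK Efin) -EFinN => -[EE].
by congr EFin; lra.
Qed.

Lemma covariance_sum0 d (T : measurableType d) (R : realType)
    (Pr : probability T R) (X : nat -> T -> R) (Y : T -> R) :
    (forall l, X l \in Lfun Pr 2%:E) -> Y \in Lfun Pr 2%:E ->
  forall k, (forall l, (l < k)%N -> covariance Pr (X l) Y = 0%E) ->
  covariance Pr (\sum_(l < k) X l) Y = 0%E.
Proof.
move=> X2 Y2; elim=> [|k IH] XY.
  by rewrite big_ord0; exact: covariance_cst_l.
rewrite big_ord_recr/= covarianceDl//; last by rewrite rpred_sum ?lee1n.
by rewrite XY// adde0 IH// => l lk; rewrite XY// ltnS ltnW.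
Qed.

Lemma variance_sum_uncorrelated d (T : measurableType d) (R : realType)
    (Pr : probability T R) (X : nat -> T -> R) (M : R) :
    (forall l, X l \in Lfun Pr 2%:E) ->
    (forall l m, (l < m)%N -> covariance Pr (X l) (X m) = 0%E) ->
    (forall l, variance Pr (X l) = M%:E) ->
  forall k, variance Pr (\sum_(l < k) X l) = (k%:R * M)%:E.
Proof.
move=> X2 cX vX; elim=> [|k IH].
  by rewrite big_ord0 mul0r; exact: variance_cst.
rewrite big_ord_recr/= varianceD//; last by rewrite rpred_sum ?lee1n.
rewrite covariance_sum0//; last by move=> l; exact: cX.
by rewrite mule0 adde0 IH vX -EFinD mulrSr mulrDl mul1r.
Qed.

Lemma mean_tail_le d (T : measurableType d) (R : realType)
    (Pr : probability T R) (X : nat -> {RV Pr >-> R}) (M : R) :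
    (forall l, (X l : T -> R) \in Lfun Pr 2%:E) ->
    (forall l, 'E_Pr[X l] = 0)%E ->
    (forall l m, (l < m)%N -> covariance Pr (X l) (X m) = 0%E) ->
    (forall l, variance Pr (X l) = M%:E) ->
  forall (delta : R) k, 0 < delta -> (0 < k)%N ->
  (Pr [set w | (delta <= `|k%:R^-1 * \sum_(l < k) X l w|)%R]
    <= (M / delta ^+ 2 / k%:R)%:E)%E.
Proof.
move=> X2 EX cX vX delta k d0 k0.
have Pfin : Pr setT \is a fin_num := fin_num_measure Pr _ measurableT.
pose S : {RV Pr >-> R} := (\sum_(l < k) X l)%R.
have SE : (S : T -> R) = \sum_(l < k) (X l : T -> R).
  by rewrite /S; elim/big_rec2: _ => // i a b _ <-.
have ES : ('E_Pr[S] = 0)%E.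
  rewrite SE; elim: (k) => [|m IH]; first by rewrite big_ord0 expectation_cst.
  rewrite big_ord_recr/= expectationD ?IH ?EX ?adde0// ?Lfun_subset12//.
  by rewrite rpred_sum ?lee1n.
have kd : 0 < k%:R * delta by rewrite mulr_gt0 ?ltr0n.
have := @chebyshev _ _ _ Pr S _ kd.
rewrite ES/= SE (variance_sum_uncorrelated X2 cX vX) => H.
apply: le_trans (le_trans H _).
  rewrite le_eqVlt; apply/orP; left; apply/eqP; congr (Pr _).
  apply/seteqP; split=> w /=; rewrite subr0 fct_sumE normrM ger0_norm ?invr_ge0//.
    by rewrite ler_pdivlMl ?ltr0n.
  by rewrite ler_pdivlMl ?ltr0n.
rewrite -EFinM lee_fin le_eqVlt; apply/orP; left; apply/eqP.
by field; rewrite !gt_eqF ?ltr0n.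
Qed.

(** The constant is the common variance; all that matters is that it depends on
neither delta nor k.  The family n may be larger than the sequence n \o u:
below it gathers both sensors, and u picks the samples of one of them. *)
Lemma gaussian_mean_tail d (T : measurableType d) (R : realType)
    (Pr : probability T R) (sigma : R) (I : choiceType)
    (n : I -> {RV Pr >-> R}) (u : nat -> I) :
    0 < sigma -> injective u ->
    (forall i, centered_gaussian sigma (n i)) -> independent_RVs n ->
  exists M : R, forall (delta : R) k, 0 < delta -> (0 < k)%N ->
  (Pr [set w | (delta <= `|k%:R^-1 * \sum_(l < k) n (u l) w|)%R]
    <= (M / delta ^+ 2 / k%:R)%:E)%E.
Proof.
move=> s0 uI gn indep.
have Pfin : Pr setT \is a fin_num := fin_num_measure Pr _ measurableT.
have n2 i : (n i : T -> R) \in Lfun Pr 2%:E := centered_gaussian_Lfun2 s0 (gn i).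
have n1 i : (n i : T -> R) \in Lfun Pr 1 by rewrite Lfun_subset12.
have En i : ('E_Pr[n i] = 0)%E := centered_gaussian_expectation s0 (gn i).
have vn l : variance Pr (n (u l)) = variance Pr (n (u 0%N)).
  by rewrite !varianceE// !En !(centered_gaussian_second_moment (gn _)).
exists (fine (variance Pr (n (u 0%N)))).
apply: (mean_tail_le (X := fun l => n (u l))) => //; last first.
  by move=> l; rewrite vn fineK// variance_fin_num.
move=> l m lm; rewrite covarianceE ?Lfun2_mul_Lfun1// !En mule0 sube0.
rewrite expectation_prod_independent// ?En ?mule0// => E F mE mF.
(* The product rule for the pair of indices u l, u m, which are distinct. *)
have uN : u l != u m by apply: contraTneq lm => /uI ->; rewrite ltnn.
pose B (i : I) := if i == u l then E else F.
have mB i : measurable (B i) by rewrite /B; case: ifP.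
have := indep [fset (u l); (u m)]%fset B mB.
rewrite big_fsetU1/= ?inE// big_seq_fset1 /B eqxx eq_sym (negbTE uN) => <-.
congr (Pr _); apply/seteqP; split=> w /=.
  move=> [Ew Fw] i /=; rewrite !inE => /orP[] /eqP ->.
    by rewrite eqxx.
  by rewrite eq_sym (negbTE uN).
move=> H; split.
  by have := H (u l); rewrite /= !inE !eqxx; apply.
by have := H (u m); rewrite /= !inE !eqxx orbT eq_sym (negbTE uN); apply.
Qed.

(** * Borel sets and Lebesgue measure of the plane *)

(** The product sigma-algebra is generated by rectangles; an open set is the
countable union of the squares with rational centres and radii 1 / (k + 1) that
it contains. *)
Lemma open_measurable_plane (R : realType) (A : set (R * R)) :
  open A -> measurable A.
Proof.
move=> oA.
pose box (q1 q2 : rat) (k : nat) : set (R * R) :=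
  ball (ratr q1 : R) k.+1%:R^-1 `*` ball (ratr q2 : R) k.+1%:R^-1.
pose inner q1 q2 k := if `[< box q1 q2 k `<=` A >] then box q1 q2 k else set0.
suff -> : A = \bigcup_q1 \bigcup_q2 \bigcup_k inner q1 q2 k.
  apply: bigcupT_measurable_rat => q1; apply: bigcupT_measurable_rat => q2.
  apply: bigcupT_measurable => k; rewrite /inner; case: ifP => _ //.
  by apply: measurableX; apply: measurable_ball.
apply/seteqP; split=> [p Ap|p [q1 _ [q2 _ [k _]]]]; last first.
  by rewrite /inner; case: ifPn => // /asboolP; apply.
have [e /= e0 pe] : exists2 e : R, 0 < e & ball p e `<=` A.
  by have /nbhs_ballP[e e0 pe] := open_nbhs_nbhs (conj oA Ap); exists e.
have [k ke] : exists k : nat, k.+1%:R^-1 + k.+1%:R^-1 < e.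
  exists (Num.truncn (2 / e)).
  rewrite -[ltLHS]mulr2n -[ltLHS]mulr_natl ltr_pdivrMr ?ltr0n//.
  by rewrite mulrC -ltr_pdivrMr// truncnS_gt.
have k0 : 0 < k.+1%:R^-1 :> R by rewrite invr_gt0 ltr0n.
have rat_close (x : R) : exists q : rat, ball x k.+1%:R^-1 (ratr q).
  have [|y [xy [q _ qy]]] := @dense_rat R (ball x k.+1%:R^-1) _ (ball_open x _).
    by exists x; exact: ballxx.
  by exists q; rewrite qy.
have [q1 p1] := rat_close p.1; have [q2 p2] := rat_close p.2.
exists q1 => //; exists q2 => //; exists k => //.
rewrite /inner ifT; first by split; exact: ball_sym.
apply/asboolP => z [z1 z2]; apply: pe; split.
  exact: (le_ball (ltW ke) (ball_triangle p1 z1)).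
exact: (le_ball (ltW ke) (ball_triangle p2 z2)).
Qed.

Lemma closed_measurable_plane (R : realType) (A : set (R * R)) :
  closed A -> measurable A.
Proof.
move=> cA; rewrite -(setCK A); apply: measurableC.
by apply: open_measurable_plane; exact: closed_openC.
Qed.

Lemma continuous_measurable_plane (R : realType) (f : R * R -> R) :
  continuous f -> measurable_fun setT f.
Proof.
move=> /continuousP cf.
apply: (measurability _ (RGenOpens.measurableE R)).
move=> _ [_ [a [b ->] <-]]; rewrite setTI.
by apply: open_measurable_plane; apply: cf; exact: interval_open.
Qed.

Lemma le_planar_measure (R : realType) (A B : set (R * R)) :
    measurable A -> measurable B -> A `<=` B ->
  (@planar_measure R A <= @planar_measure R B)%E.
Proof.
by move=> mA mB AB; apply: le_measure => //; rewrite inE; [exact: mA|exact: mB].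
Qed.

Lemma compact_planar_measure_lty (R : realType) (A : set (R * R)) :
  compact A -> (@planar_measure R A < +oo)%E.
Proof.
move=> cA; have mA : measurable A.
  by apply: closed_measurable_plane; exact: compact_closed.
have [N [_ NA]] := compact_bounded cA.
pose I : set R := `[- (`|N| + 1), `|N| + 1]%classic.
have AI : A `<=` I `*` I.
  move=> p /(NA (`|N| + 1)).
  rewrite ltr_pwDr ?ler_norm// => /(_ isT) /=.
  rewrite prod_normE ge_max => /andP[p1 p2].
  by split; rewrite /I/= in_itv/= -ler_norml.
have mI : measurable I by exact: measurable_itv.
apply: (@le_lt_trans _ _ (@planar_measure R (I `*` I))).
  by apply: le_planar_measure => //; exact: measurableX.
rewrite /planar_measure product_measure1E//=.
have -> : lebesgue_measure I = (`|N| + 1 + (`|N| + 1))%:E.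
  by rewrite /I lebesgue_measure_itv/= lte_fin gtrN ?ltr_wpDl// -EFinD opprK.
by rewrite -EFinM ltry.
Qed.

Lemma planar_measure_ball_gt0 (R : realType) (p : R * R) (e : R) :
  0 < e -> (0 < @planar_measure R (ball p e))%E.
Proof.
move=> e0.
have -> : ball p e = ball p.1 e `*` ball p.2 e by [].
rewrite /planar_measure product_measure1E/=; [|exact: measurable_ball..].
by rewrite !lebesgue_measure_ball ?ltW// -EFinM lte_fin mulr_gt0// pmulrn_lgt0.
Qed.

(** * The signal model *)

Lemma edist_ge0 (R : realType) (u v : R * R) : 0 <= edist u v.
Proof. exact: sqrtr_ge0. Qed.

Lemma edistC (R : realType) (u v : R * R) : edist u v = edist v u.
Proof. by rewrite /edist -(sqrrN (u.1 - _)) -(sqrrN (u.2 - _)) !opprB. Qed.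

Lemma continuous_edist (R : realType) (u : R * R) : continuous (edist u).
Proof.
move=> v; apply: (@continuous_comp _ _ _
  (fun y : R * R => (u.1 - y.1) ^+ 2 + (u.2 - y.2) ^+ 2) Num.sqrt).
  rewrite /continuous_at; apply: cvgD.
    by under eq_cvg do rewrite expr2; rewrite expr2;
       apply: cvgM; (apply: cvgB; [exact: cvg_cst|exact: cvg_fst]).
  by under eq_cvg do rewrite expr2; rewrite expr2;
     apply: cvgM; (apply: cvgB; [exact: cvg_cst|exact: cvg_snd]).
exact: sqrt_continuous.
Qed.

(** Continuity at distance 0 is needed because the source may sit on a sensor;
there it comes from t ^ beta <= t for small t. *)
Lemma continuous_edist_powR (R : realType) (beta : R) (u : R * R) : 1 <= beta ->
  continuous (fun v => edist u v `^ beta).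
Proof.
move=> b1 v.
have b0 : 0 < beta by rewrite (lt_le_trans ltr01).
have := edist_ge0 u v; rewrite le_eqVlt => /predU1P[uv|uv]; last first.
  apply: (@continuous_comp _ _ _ (edist u) (fun t => t `^ beta)).
    exact: continuous_edist.
  apply/differentiable_continuous/derivable1_diffP/derivable_powR.
  by rewrite in_itv/= uv.
rewrite /continuous_at -uv powR0 ?gt_eqF//.
have cuv : edist u y @[y --> v] --> (0 : R).
  by rewrite uv; exact: continuous_edist.
apply: (squeeze_cvgr (f := fun=> 0) (h := edist u)) => //; last exact: cvg_cst.
have : \forall y \near v, edist u y < 1 by exact: (cvgr_lt 0 cuv).
apply: filterS => y y1; rewrite powR_ge0/=.
have := edist_ge0 u y; rewrite le_eqVlt => /predU1P[<-|y0].
  by rewrite powR0 ?gt_eqF.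
by rewrite ge1r_powR// y0 ltW.
Qed.

Lemma log_meanE (R : realType) (P d0 beta : R) (xi y : R * R) :
  0 < P -> 0 < d0 ->
  log_mean P d0 beta xi y = ln (P * d0) - ln (d0 + edist xi y `^ beta).
Proof.
move=> P0 d0_gt0; rewrite /log_mean ln_div// posrE ?mulr_gt0//.
by rewrite ltr_pwDl// powR_ge0.
Qed.

Lemma continuous_log_mean (R : realType) (P d0 beta : R) (xi : R * R) :
  0 < P -> 0 < d0 -> 1 <= beta -> continuous (log_mean P d0 beta xi).
Proof.
move=> P0 d0_gt0 b1 y; rewrite /continuous_at log_meanE//.
under eq_cvg do rewrite log_meanE//.
apply: cvgB; first exact: cvg_cst.
apply: (@continuous_comp _ _ _ (fun y => d0 + edist xi y `^ beta) (@ln R)).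
  by apply: cvgD; [exact: cvg_cst|exact: continuous_edist_powR].
by apply: continuous_ln; rewrite ltr_pwDl// powR_ge0.
Qed.

(** The noiseless log-measurement as a function of the distance t. *)
Definition log_power (R : realType) (P d0 beta t : R) : R :=
  ln (P * d0) - ln (d0 + t `^ beta).

Lemma log_power_decreasing (R : realType) (P d0 beta t u : R) :
  0 < d0 -> 0 < beta -> 0 <= t -> t < u ->
  log_power P d0 beta u < log_power P d0 beta t.
Proof.
move=> d0_gt0 b0 t0 tu.
have den_gt0 v : 0 < d0 + v `^ beta by rewrite ltr_pwDl// powR_ge0.
rewrite /log_power ltrD2l ltrN2 ltr_ln ?posrE ?den_gt0// ltrD2l.
by rewrite gt0_ltr_powR// nnegrE// ltW// (le_lt_trans t0).
Qed.

Lemma log_power_nonincreasing (R : realType) (P d0 beta t u : R) :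
  0 < d0 -> 0 < beta -> 0 <= t -> t <= u ->
  log_power P d0 beta u <= log_power P d0 beta t.
Proof.
move=> d0_gt0 b0 t0; rewrite le_eqVlt => /predU1P[->//|tu].
exact/ltW/log_power_decreasing.
Qed.

(** With t midway between the distances from s to x1 and x2, a point y nearer
to x2 either is within t of x2, which receives too much, or is further than t
from x1, which receives too little. *)
Lemma log_mean_gap (R : realType) (P d0 beta : R) (x1 x2 s : R * R) :
    0 < P -> 0 < d0 -> 0 < beta -> edist s x1 < edist s x2 ->
  exists2 eta : R, 0 < eta & forall y, edist y x2 <= edist y x1 ->
    eta <= `|log_mean P d0 beta x1 s - log_mean P d0 beta x1 y| \/
    eta <= `|log_mean P d0 beta x2 s - log_mean P d0 beta x2 y|.
Proof.
move=> P0 d0_gt0 b0; set r1 := edist s x1; set r2 := edist s x2 => r12.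
have r1_ge0 : 0 <= r1 by exact: edist_ge0.
pose t := (r1 + r2) / 2.
have [r1t tr2] : r1 < t /\ t < r2 by split; rewrite /t; lra.
have t_ge0 : 0 <= t by lra.
pose g := log_power P d0 beta.
have gE xi y : log_mean P d0 beta xi y = g (edist y xi).
  by rewrite (log_meanE _ _ _ P0 d0_gt0) (edistC xi).
have g1 : g t < g r1 by exact: log_power_decreasing.
have g2 : g r2 < g t by exact: log_power_decreasing.
exists (Num.min (g r1 - g t) (g t - g r2)).
  by rewrite lt_min !subr_gt0 g1 g2.
move=> y yx; rewrite !gE -/r1 -/r2.
have [y2|y2] := leP (edist y x2) t; [right|left].
  have gy : g t <= g (edist y x2).
    by apply: log_power_nonincreasing => //; exact: edist_ge0.
  rewrite ge_min; apply/orP; right.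
  by rewrite distrC (le_trans _ (ler_norm _))// lerD2r.
have gy : g (edist y x1) <= g t.
  by apply: log_power_nonincreasing => //; rewrite (le_trans (ltW y2)).
rewrite ge_min; apply/orP; left.
by rewrite (le_trans _ (ler_norm _))// lerD2l lerN2.
Qed.

Lemma closed_voronoi (R : realType) (C : set (R * R)) (x : 'I_2 -> R * R) j :
  closed C -> closed (voronoi C x j).
Proof.
move=> cC.
have -> : voronoi C x j = C `&` \bigcap_(l in [set: 'I_2])
    [set y | edist (x j) y - edist (x l) y <= 0].
  apply/seteqP; split=> y [Cy H]; split=> // l.
    by move=> _ /=; rewrite subr_le0 !(edistC (x _)).
  by have := H l I; rewrite /= subr_le0 !(edistC (x _)).
apply: closedI => //; apply: closed_bigI => l _.
apply: (@closed_comp _ _ (fun y => edist (x j) y - edist (x l) y)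
  [set t | t <= 0]).
  move=> y _; apply: cvgB; exact: continuous_edist.
exact: closed_le.
Qed.

(** * Concentration of the MAP score *)

Lemma le_norm_integrable d (T : measurableType d) (R : realType)
    (mu : {measure set T -> \bar R}) (V : set T) (f : T -> R) (M : R) :
    measurable V -> (mu V < +oo)%E -> measurable_fun V f ->
    (forall x, V x -> `|f x| <= M) ->
  mu.-integrable V (EFin \o f).
Proof.
move=> mV Voo mf fM; apply: measurable_bounded_integrable => //.
exists M; split; first exact: num_real.
by move=> y My x Vx /=; rewrite (le_trans (fM x Vx))// ltW.
Qed.

Lemma Rintegral_le_const d (T : measurableType d) (R : realType)
    (mu : {measure set T -> \bar R}) (V : set T) (f : T -> R) (M : R) :
    (forall x, 0 <= f x) -> measurable V -> (mu V < +oo)%E ->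
    measurable_fun V f -> (forall x, V x -> f x <= M) ->
  \int[mu]_(x in V) f x <= M * fine (mu V).
Proof.
move=> f_ge0 mV Voo mf fM; rewrite -Rintegral_cst//.
apply: le_Rintegral => //; last by apply: (le_norm_integrable (M := `|M|)).
by apply: (le_norm_integrable (M := M)) => // x Vx; rewrite ger0_norm ?fM.
Qed.

Lemma Rintegral_ge_const d (T : measurableType d) (R : realType)
    (mu : {measure set T -> \bar R}) (B V : set T) (f : T -> R) (m M : R) :
    (forall x, 0 <= f x) -> measurable B -> measurable V -> B `<=` V ->
    (mu V < +oo)%E -> measurable_fun V f -> (forall x, V x -> f x <= M) ->
    (forall x, B x -> m <= f x) ->
  m * fine (mu B) <= \int[mu]_(x in V) f x.
Proof.
move=> f_ge0 mB mV BV Voo mf fM mfB; rewrite -Rintegral_cst//.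
have Boo : (mu B < +oo)%E.
  by apply: le_lt_trans Voo; apply: le_measure; rewrite ?inE.
have iV : mu.-integrable V (EFin \o f).
  by apply: (le_norm_integrable (M := M)) => // x Vx; rewrite ger0_norm ?fM.
have iB := integrableS mV mB BV iV.
apply: (@le_trans _ _ (\int[mu]_(x in B) f x)).
  apply: le_Rintegral => //.
  by apply: (le_norm_integrable (M := `|m|)).
rewrite /Rintegral fine_le ?integrable_fin_num//.
apply: ge0_subset_integral => //; first exact/measurable_EFinP.
by move=> x _; rewrite lee_fin.
Qed.

(** A point of a regular closed set may lie on its boundary, so the ball is not
centred at s. *)
Lemma regular_closed_ball (R : realType) (C : set (R * R)) (s : R * R)
    (U : R * R -> Prop) : closure (interior C) = C -> C s ->
    (\forall y \near s, U y) ->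
  exists p, exists2 r : R, 0 < r & forall y, ball p r y -> C y /\ U y.
Proof.
move=> regC Cs Us.
have [p [Cp Up]] : (interior C `&` interior [set y | U y]) !=set0.
  have : closure (interior C) s by rewrite regC.
  by apply; exact: nbhs_interior.
have [r /= r0 pr] := (@nbhs_ballP _ _ p _).1 (filterI Cp Up).
by exists p, r => // y /pr.
Qed.

Lemma ord2_cases (i j l : 'I_2) : i != j -> l = i \/ l = j.
Proof.
by case: i j l => [[|[|[]]] // ?] [[|[|[]]] // ?] [[|[|[]]] // ?] // _;
  [left|right|right|left]; exact: val_inj.
Qed.

Lemma prod_gaussian_kernel (R : realType) (c v : R) (q : 'I_2 -> R) :
  \prod_(l < 2) (c * expR (- (q l / (2 * v)))) =
  c ^+ 2 * expR (- ((\sum_(l < 2) q l) / (2 * v))).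
Proof.
rewrite !big_ord_recl !big_ord0 mulr1 addr0; set w := 2 * v.
by rewrite mulrDl opprD expRD; ring.
Qed.

(** From exp u >= 1 + u, it suffices that |a| < b c k. *)
Lemma expR_decay_lt (R : realType) (a b c : R) : 0 < b -> 0 < c ->
  exists N : nat, forall k, (N < k)%N -> a * expR (- (c * k%:R)) < b.
Proof.
move=> b0 c0; exists (Num.truncn (`|a| / (b * c))) => k Nk.
rewrite expRN ltr_pdivrMr ?expR_gt0//.
apply: le_lt_trans (ler_norm a) _.
have ak : `|a| < b * (c * k%:R).
  rewrite mulrA mulrC -ltr_pdivrMr ?mulr_gt0//.
  by rewrite (lt_le_trans (truncnS_gt _))// ler_nat.
rewrite (lt_le_trans ak)// ler_pM2l// (le_trans _ (expR_ge1Dx _))//.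
by rewrite lerDr.
Qed.

Lemma measurable_gaussian_kernel (R : realType) (c w : R) (z : 'I_2 -> R)
    (m : 'I_2 -> R * R -> R) : (forall l, continuous (m l)) ->
  measurable_fun setT
    (fun y => c * expR (- ((\sum_(l < 2) (z l - m l y) ^+ 2) / w))).
Proof.
move=> cm.
apply: measurable_funM => //; apply: measurableT_comp => //.
apply: measurableT_comp => //; apply: measurable_funM => //.
apply: measurable_sum => l; apply: measurable_funX.
by apply: measurable_funB => //; exact: continuous_measurable_plane.
Qed.

Lemma sumsq_le (R : realDomainType) (a b : 'I_2 -> R) (e : R) :
  (forall l, `|a l - b l| <= e) -> \sum_(l < 2) (a l - b l) ^+ 2 <= e ^+ 2 *+ 2.
Proof.
move=> ab; have sq l : (a l - b l) ^+ 2 <= e ^+ 2.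
  by rewrite -real_normK ?num_real// lerXn2r ?nnegrE ?(le_trans _ (ab l)).
by rewrite big_ord_recl big_ord1 mulr2n lerD.
Qed.

Lemma sumsq_ge (R : realDomainType) (a b : 'I_2 -> R) (e : R) (l0 : 'I_2) :
  0 <= e -> e <= `|a l0 - b l0| -> e ^+ 2 <= \sum_(l < 2) (a l - b l) ^+ 2.
Proof.
move=> e0 ab; rewrite (bigD1 l0)//= ler_wpDr ?sumr_ge0//.
  by move=> l _; rewrite sqr_ge0.
by rewrite -[leRHS]real_normK ?num_real// lerXn2r ?nnegrE.
Qed.

(** Here and in the next lemma, a is the noiseless value at the source, b the
one at another point, and z the measurement. *)
Lemma misfit_dist_ge (R : realFieldType) (a b z eta : R) :
  `|z - a| < eta / 8 -> eta <= `|a - b| -> 7 / 8 * eta <= `|z - b|.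
Proof.
move=> za ab; have := ler_distD z a b.
by rewrite (distrC a z); lra.
Qed.

Lemma fit_dist_le (R : realFieldType) (a b z eta : R) :
  `|z - a| < eta / 8 -> `|a - b| < eta / 8 -> `|z - b| <= eta / 4.
Proof. by move=> za ab; have := ler_distD a z b; lra. Qed.

(** Laplace's method.  With Q the squared misfit to the measurements z, one has
Q >= (7 eta / 8) ^ 2 >= eta ^ 2 / 2 on the region i, whereas
Q <= 2 (eta / 4) ^ 2 = eta ^ 2 / 8 on a ball inside the region j. *)
Lemma map_score_separation (R : realType) (P d0 beta sigma : R)
    (C : set (R * R)) (x : 'I_2 -> R * R) (s : R * R) (i j : 'I_2) :
    0 < P -> 0 < d0 -> 1 <= beta -> 0 < sigma ->
    compact_connected_region C -> C s -> edist s (x j) < edist s (x i) ->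
  exists2 delta : R, 0 < delta & exists N : nat, forall k, (N < k)%N ->
    forall z : 'I_2 -> R,
      (forall l, `|z l - log_mean P d0 beta (x l) s| < delta) ->
    map_score P d0 beta C x (sigma ^+ 2 / k%:R) z i <
    map_score P d0 beta C x (sigma ^+ 2 / k%:R) z j.
Proof.
move=> P0 d0_gt0 b1 s0 [cptC _ regC] Cs sji.
have b0 : 0 < beta by rewrite (lt_le_trans ltr01).
have ij : j != i by apply: contraTneq sji => ->; rewrite ltxx.
pose m l := log_mean P d0 beta (x l).
have cm l : continuous (m l) by exact: continuous_log_mean.
have clC : closed C by exact: compact_closed.
have [eta eta0 gap] := log_mean_gap P0 d0_gt0 b0 sji.
pose e := eta / 8; have e0 : 0 < e by rewrite divr_gt0.
have near_m l : \forall y \near s, `|m l s - m l y| < e.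
  by have /cvgrPdist_lt/(_ e e0) := cm l s.
have near_d : \forall y \near s, 0 < edist (x i) y - edist (x j) y.
  have dji : 0 < edist (x i) s - edist (x j) s.
    by rewrite subr_gt0 !(edistC (x _)).
  have cd : edist (x i) y - edist (x j) y @[y --> s] -->
      edist (x i) s - edist (x j) s.
    by apply: cvgB; exact: continuous_edist.
  by apply: (cvgr_gt _ cd).
have [p [r r0 pC]] : exists p, exists2 r : R, 0 < r & forall y, ball p r y ->
    C y /\ (edist y (x j) < edist y (x i) /\ forall l, `|m l s - m l y| < e).
  apply: (regular_closed_ball regC Cs).
  apply: filterS3 near_d (near_m i) (near_m j) => y yd ymi ymj.
  split; first by rewrite -subr_gt0 !(edistC y).
  by move=> l; have [->|->] := ord2_cases l ij.
pose mu := @planar_measure R.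
have mB : measurable (ball p r).
  by apply: open_measurable_plane; exact: ball_open.
have mV l : measurable (voronoi C x l).
  by apply: closed_measurable_plane; exact: closed_voronoi.
have Coo : (mu C < +oo)%E by exact: compact_planar_measure_lty.
have mC : measurable C by exact: closed_measurable_plane.
have Voo l : (mu (voronoi C x l) < +oo)%E.
  by apply: le_lt_trans Coo; apply: le_planar_measure => // y [].
have BV : ball p r `<=` voronoi C x j.
  move=> y /pC[Cy [yji _]]; split=> // l.
  by have [->|->] := ord2_cases l ij; rewrite // ltW.
have Bgt0 : 0 < fine (mu (ball p r)).
  rewrite fine_gt0// planar_measure_ball_gt0//=.
  by apply: le_lt_trans (Voo j); exact: le_planar_measure.
have Cgt0 : 0 < fine (mu C).
  rewrite fine_gt0// Coo andbT (lt_le_trans (planar_measure_ball_gt0 p r0))//.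
  by apply: le_planar_measure => // y /pC[].
(* The rate at which the ratio of the two exponentials decays with k. *)
pose c := (eta ^+ 2 / 2 - eta ^+ 2 / 8) / (2 * sigma ^+ 2).
have c0 : 0 < c.
  rewrite divr_gt0 ?mulr_gt0 ?exprn_gt0// subr_gt0.
  by rewrite ltr_pM2l ?exprn_gt0// ltf_pV2 ?posrE// ltr_nat.
have [N HN] := expR_decay_lt (fine (mu (voronoi C x i))) Bgt0 c0.
exists e => //; exists N => k Nk z zm.
have k0 : (0 : R) < k%:R by rewrite ltr0n (leq_trans _ Nk).
set v := sigma ^+ 2 / k%:R.
have v0 : 0 < v by rewrite divr_gt0 ?exprn_gt0.
rewrite /map_score -/mu ltr_pM2l ?invr_gt0//.
pose K := (Num.sqrt (2 * pi * v))^-1 ^+ 2.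
have K0 : 0 < K.
  by rewrite exprn_gt0// invr_gt0 sqrtr_gt0 mulr_gt0// mulr_gt0// pi_gt0.
pose f y := K * expR (- ((\sum_(l < 2) (z l - m l y) ^+ 2) / (2 * v))).
under eq_Rintegral do rewrite prod_gaussian_kernel.
under [ltRHS]eq_Rintegral do rewrite prod_gaussian_kernel.
rewrite -/K.
change (\int[mu]_(y in voronoi C x i) f y < \int[mu]_(y in voronoi C x j) f y).
have f0 y : 0 <= f y by rewrite mulr_ge0 ?expR_ge0 ?ltW.
have mf V : measurable_fun V f.
  by apply: measurable_funTS; exact: measurable_gaussian_kernel.
have f_le y q : q <= \sum_(l < 2) (z l - m l y) ^+ 2 ->
    f y <= K * expR (- (q / (2 * v))).
  by move=> qy; rewrite ler_pM2l// ler_expR lerN2 ler_pM2r// invr_gt0 mulr_gt0.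
have f_ge y q : \sum_(l < 2) (z l - m l y) ^+ 2 <= q ->
    K * expR (- (q / (2 * v))) <= f y.
  by move=> qy; rewrite ler_pM2l// ler_expR lerN2 ler_pM2r// invr_gt0 mulr_gt0.
have fK y : f y <= K.
  rewrite (le_trans (f_le y 0 _)) ?sumr_ge0 ?mul0r ?oppr0 ?expR0 ?mulr1//.
  by move=> l _; rewrite sqr_ge0.
have up : \int[mu]_(y in voronoi C x i) f y <=
    K * expR (- (eta ^+ 2 / 2 / (2 * v))) * fine (mu (voronoi C x i)).
  apply: Rintegral_le_const;
    [exact: f0|exact: mV|exact: Voo|exact: mf|] => y [Cy /(_ j) yij].
  apply: f_le; rewrite (@le_trans _ _ ((7 / 8 * eta) ^+ 2))//.
    by have := sqr_ge0 eta; nra.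
  have far l : eta <= `|m l s - m l y| -> 7 / 8 * eta <= `|z l - m l y|.
    by move=> ely; exact: misfit_dist_ge (zm l) ely.
  have h0 : 0 <= 7 / 8 * eta by rewrite mulr_ge0 ?ltW.
  by have [/far|/far] := gap y yij; exact: sumsq_ge.
have lo : K * expR (- (eta ^+ 2 / 8 / (2 * v))) * fine (mu (ball p r)) <=
    \int[mu]_(y in voronoi C x j) f y.
  apply: (Rintegral_ge_const (M := K)); [exact: f0|exact: mB|exact: mV|
    exact: BV|exact: Voo|exact: mf|by []|] => y /pC[_ [_ ym]].
  apply: f_ge; rewrite (@le_trans _ _ ((eta / 4) ^+ 2 *+ 2))//; last first.
    by rewrite le_eqVlt; apply/orP; left; apply/eqP; field.
  apply: sumsq_le => l.
  exact: fit_dist_le (zm l) (ym l).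
apply: le_lt_trans up _; apply: lt_le_trans lo.
rewrite -[ltLHS]mulrA -[ltRHS]mulrA ltr_pM2l//.
have -> : - (eta ^+ 2 / 2 / (2 * v)) = - (eta ^+ 2 / 8 / (2 * v)) - c * k%:R.
  by rewrite /c /v; field; rewrite !gt_eqF.
by rewrite expRD -[ltLHS]mulrA ltr_pM2l ?expR_gt0// mulrC HN.
Qed.

(** * Consistency *)

Lemma cvg_inv_nat (R : realType) (c : R) :
  (c / k%:R)%:E @[k --> \oo] --> (0%E : \bar R).
Proof.
apply: cvg_EFin; first exact: nearW.
rewrite -cvg_shiftS /=.
have : c * harmonic k @[k --> \oo] --> c * 0.
  by apply: cvgM; [exact: cvg_cst|exact: cvg_harmonic].
by rewrite mulr0.
Qed.

(** The MAP rule errs exactly when it selects the region i; its score is then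
at least that of j, which the separation of the scores forbids unless one of the
averages of the noise exceeds delta. *)
Lemma MAP_strict_consistency (R : realType) (P d0 beta sigma : R)
    (C : set (R * R)) (x : 'I_2 -> R * R) (s : R * R)
    (d : measure_display) (T : measurableType d) (Pr : probability T R)
    (n : 'I_2 -> nat -> {RV Pr >-> R}) (jstar : nat -> T -> 'I_2) (i j : 'I_2) :
    0 < P -> 0 < d0 -> 1 <= beta -> 0 < sigma ->
    compact_connected_region C -> C s ->
    (forall i l, centered_gaussian sigma (n i l)) ->
    independent_RVs (fun il : 'I_2 * nat => n il.1 il.2) ->
    MAP_rule P d0 beta sigma C x s n jstar ->
    edist s (x j) < edist s (x i) ->
  Pr [set w | ~ voronoi C x (jstar k w) s] @[k --> \oo] --> 0%E.
Proof.
move=> P0 d0_gt0 b1 s0 regC Cs gn indep MAP sji.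
have ij : j != i by apply: contraTneq sji => ->; rewrite ltxx.
have [delta delta0 [N sep]] :=
  map_score_separation P0 d0_gt0 b1 s0 regC Cs sji.
have tail l : exists M : R, forall k, (0 < k)%N ->
    (Pr [set w | (delta <= `|k%:R^-1 * \sum_(t < k) n l t w|)%R]
      <= (M / delta ^+ 2 / k%:R)%:E)%E.
  have [||M HM] := @gaussian_mean_tail _ _ _ Pr sigma _
     (fun il : 'I_2 * nat => n il.1 il.2) (fun t => (l, t)) s0 _ _ indep.
  - by move=> t t' [].
  - by move=> il; exact: gn.
  by exists M => k k0; exact: HM.
have [Mi HMi] := tail i; have [Mj HMj] := tail j.
pose c := (Mi + Mj) / delta ^+ 2.
apply: (squeeze_cvge (f := fun=> 0%E) (h := fun k => (c / k%:R)%:E));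
  [|exact: cvg_cst|exact: cvg_inv_nat].
exists N.+1 => // k /= Nk; rewrite measure_ge0/=.
have k0 : (0 < k)%N by apply: leq_trans Nk.
have [mjs js] := MAP k k0.
pose bad l := [set w | (delta <= `|k%:R^-1 * \sum_(t < k) n l t w|)%R].
have mbad l : measurable (bad l).
  have mf : measurable_fun setT (fun w => `|k%:R^-1 * \sum_(t < k) n l t w|).
    apply: measurableT_comp => //; apply: measurable_funM => //.
    exact: measurable_sum.
  rewrite (_ : bad l =
      (fun w => `|k%:R^-1 * \sum_(t < k) n l t w|) @^-1` `[delta, +oo[).
    by rewrite -[X in measurable X]setTI; exact: mf.
  by apply/seteqP; split=> w /=; rewrite in_itv/= andbT.
have errE : [set w | ~ voronoi C x (jstar k w) s] = [set w | jstar k w = i].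
  apply/seteqP; split=> w /=.
    have [-> []|->//] := ord2_cases (jstar k w) ij.
    by split=> // l; have [->|->] := ord2_cases l ij; rewrite // ltW.
  by move=> -> [_ /(_ j)]; rewrite leNgt sji.
rewrite errE (@le_trans _ _ (Pr (bad i `|` bad j)))//.
  apply: le_measure; rewrite ?inE//; first exact: measurableU.
  move=> w /= jw; apply: contrapT => nbad.
  have := js w j; rewrite jw /= leNgt => /negP; apply.
  apply: sep => // l.
  have aggE : aggregated P d0 beta x s n k w l - log_mean P d0 beta (x l) s =
      k%:R^-1 * \sum_(t < k) n l t w.
    rewrite /aggregated /log_measurement big_split/= sumr_const card_ord.
    rewrite mulrDr -[log_mean _ _ _ _ _ *+ _]mulr_natl.
    by rewrite mulKf ?pnatr_eq0 -?lt0n// addrAC subrr add0r.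
  rewrite aggE ltNge; apply/negP => lbad; apply: nbad.
  by have [lE|lE] := ord2_cases l ij; [right|left]; rewrite /bad /= -lE.
apply: (le_trans (measureU2 _ (mbad i) (mbad j))).
apply: (le_trans (leeD (HMi k k0) (HMj k k0))).
by rewrite -EFinD lee_fin /c mulrDl mulrDl.
Qed.

Theorem mainTheorem3 (R : realType) (P d0 beta sigma : R)
  (P_gt0 : 0 < P) (d0_gt0 : 0 < d0) (beta_gt2 : 2 < beta)
  (sigma_gt0 : 0 < sigma)
  (C : set (R * R)) (C_region : compact_connected_region C)
  (x : 'I_2 -> R * R) (x_in : forall i, C (x i)) (x_neq : x 0 <> x 1)
  (s : R * R) (s_in : C s)
  (d : measure_display) (T : measurableType d) (Pr : probability T R)
  (n : 'I_2 -> nat -> {RV Pr >-> R})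
  (n_gauss : forall i l, centered_gaussian sigma (n i l))
  (n_indep : independent_RVs (fun il : 'I_2 * nat => n il.1 il.2))
  (jstar : nat -> T -> 'I_2)
  (jstar_MAP : MAP_rule P d0 beta sigma C x s n jstar) :
  Pr [set w | ~ voronoi C x (jstar k w) s] @[k --> \oo] --> 0%E.
Proof.
have b1 : 1 <= beta by lra.
have [s01|s10|seq] := ltgtP (edist s (x 0)) (edist s (x 1)).
- exact: (MAP_strict_consistency P_gt0 d0_gt0 b1 sigma_gt0 C_region s_in
    n_gauss n_indep jstar_MAP s01).
- exact: (MAP_strict_consistency P_gt0 d0_gt0 b1 sigma_gt0 C_region s_in
    n_gauss n_indep jstar_MAP s10).
have both l : voronoi C x l s.
  have sl (m : 'I_2) : edist s (x m) = edist s (x 0).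
    by have [->|->] := @ord2_cases 0 1 m isT.
  by split=> // m; rewrite !sl.
apply: cvg_near_cst; apply: nearW => k.
by rewrite (_ : [set _ | _] = set0) ?measure0//; apply/seteqP; split=> w //= [].
Qed.
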